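(* Let $G$ be a countable abelian (discrete) group and let $\nu$ be a regular Borel measure on the dual group $\widehat G$. The representation $\pi_\nu$ of $G$ on $L^2(\widehat G,\nu)$ given by $$(\pi_\nu(g)f)(\xi)=\overline{\xi(g)}\,f(\xi)\qquad(g\in G,\ \xi\in\widehat G,\ f\in L^2(\widehat G,\nu))$$ has almost invariant vectors if and only if the identity element $\mathrm{id}_{\widehat G}$ of $\widehat G$ belongs to the support of $\nu$.
   Context: ''Countable'' means countably infinite. $\widehat G$ is the Pontryagin dual of the discrete group $G$: the compact abelian group of all group homomorphisms $\xi:G\to\mathbb T$ with the topology of compact convergence (here, pointwise convergence on $G$); its identity element is the trivial character. The support $\operatorname{supp}\nu$ of a regular Borel measure $\nu$ on $\widehat G$ is the smallest compact set of full measure, equivalently the complement of the largest open set of $\nu$-measure zero; so $x\in\operatorname{supp}\nu$ iff every neighborhood of $x$ has positive $\nu$-measure. A unitary representation $\pi$ of $G$ on a Hilbert space $H$ has almost invariant vectors if there is a net $(v_i)_{i\in I}$ of unit vectors in $H$ with $\|\pi(g)v_i-v_i\|\to0$ for every $g\in G$. *)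

(* Defs.v *)
From HB Require Import structures.
From mathcomp Require Import all_boot all_order all_algebra.
From mathcomp Require Import all_classical all_reals all_analysis.
From mathcomp Require Import measurable_realfun complex.

Set Implicit Arguments.
Unset Strict Implicit.
Unset Printing Implicit Defensive.

Import Order.TTheory GRing.Theory Num.Theory.
Import numFieldTopology.Exports numFieldNormedType.Exports.
Import ComplexField.Normc.

Local Open Scope classical_set_scope.
Local Open Scope ring_scope.
Local Open Scope complex_scope.
Local Open Scope quotient_scope.

Section L2.
Context d (T : measurableType d) (R : realType).
Variable mu : {measure set T -> \bar R}.
Implicit Types f g : T -> R[i].

(* Measurability for the Borel sigma-algebra of the complex plane, i.e. of the
   product of two copies of the real line. *)
Definition cmeasurable f : Prop :=
  measurable_fun [set: T] (fun x => complex.Re (f x)) /\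
  measurable_fun [set: T] (fun x => complex.Im (f x)).

Definition modulus f : T -> R := fun x => normc (f x).

Definition L2norm f : \bar R := 'N[mu]_2%:E[EFin \o modulus f].

Definition L2pred : {pred T -> R[i]} :=
  [pred f | `[< cmeasurable f /\ (L2norm f < +oo)%E >]].

Lemma L2predP f : reflect (cmeasurable f /\ (L2norm f < +oo)%E) (f \in L2pred).
Proof. by rewrite inE; exact: asboolP. Qed.

Lemma normc_ReIm (z : R[i]) :
  normc z = Num.sqrt (complex.Re z ^+ 2 + complex.Im z ^+ 2).
Proof. by case: z. Qed.

Lemma normc_ge0 (z : R[i]) : 0 <= normc z.
Proof. by rewrite normc_ReIm sqrtr_ge0. Qed.

Lemma measurable_modulus f : cmeasurable f -> measurable_fun [set: T] (modulus f).
Proof.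
move=> [mr mi].
rewrite (_ : modulus f = (@Num.sqrt R) \o
   ((fun x => complex.Re (f x) ^+ 2) \+ (fun x => complex.Im (f x) ^+ 2))); last first.
  by apply/funext => x; rewrite /modulus normc_ReIm.
apply: measurableT_comp.
  apply: continuous_measurable_fun; exact: sqrt_continuous.
by apply: measurable_funD; exact: measurable_funX.
Qed.

Lemma cmeasurable0 : cmeasurable 0.
Proof. by split; exact: measurable_cst. Qed.

Lemma cmeasurableD f g : cmeasurable f -> cmeasurable g -> cmeasurable (f + g).
Proof.
move=> [fr fi] [gr gi]; split.
- rewrite (_ : (fun x => _) = (fun x => complex.Re (f x)) \+ (fun x => complex.Re (g x))).
    exact: measurable_funD.
  by apply/funext => x /=; rewrite -[(f + g) x]/(f x + g x); case: (f x); case: (g x).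
- rewrite (_ : (fun x => _) = (fun x => complex.Im (f x)) \+ (fun x => complex.Im (g x))).
    exact: measurable_funD.
  by apply/funext => x /=; rewrite -[(f + g) x]/(f x + g x); case: (f x); case: (g x).
Qed.

Lemma cmeasurableM f g :
  cmeasurable f -> cmeasurable g -> cmeasurable (fun x => f x * g x).
Proof.
move=> [fr fi] [gr gi]; split.
- rewrite (_ : (fun x => _) =
     ((fun x => complex.Re (f x)) \* (fun x => complex.Re (g x))) \-
     ((fun x => complex.Im (f x)) \* (fun x => complex.Im (g x)))).
    by apply: measurable_funB; exact: measurable_funM.
  by apply/funext => x /=; case: (f x); case: (g x).
- rewrite (_ : (fun x => _) =
     ((fun x => complex.Re (f x)) \* (fun x => complex.Im (g x))) \+
     ((fun x => complex.Im (f x)) \* (fun x => complex.Re (g x)))).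
    by apply: measurable_funD; exact: measurable_funM.
  by apply/funext => x /=; case: (f x); case: (g x).
Qed.

Lemma cmeasurable_cst (a : R[i]) : cmeasurable (fun=> a).
Proof. by split; exact: measurable_cst. Qed.

Lemma cmeasurableZ (a : R[i]) f : cmeasurable f -> cmeasurable (a *: f).
Proof. by move=> mf; apply: cmeasurableM => //; exact: cmeasurable_cst. Qed.

Lemma L2norm_ge0 f : (0 <= L2norm f)%E.
Proof. exact: Lnorm_ge0. Qed.

Lemma eq_L2norm f g : (forall x, normc (f x) = normc (g x)) -> L2norm f = L2norm g.
Proof.
by move=> fg; apply: eq_Lnorm => x /=; rewrite /modulus fg.
Qed.

Lemma L2norm0 : L2norm 0 = 0%E.
Proof.
rewrite -[RHS](@Lnorm0 _ _ _ mu 2%:E) //.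
by apply: eq_Lnorm => x /=; rewrite /modulus normc0.
Qed.

Lemma L2normD f g : cmeasurable f -> cmeasurable g ->
  (L2norm (f + g)%R <= L2norm f + L2norm g)%E.
Proof.
move=> mf mg.
have mF := measurable_modulus mf; have mG := measurable_modulus mg.
have mH := measurable_modulus (cmeasurableD mf mg).
apply: le_trans (eminkowski mu mF mG _); last by rewrite lee_fin ler1n.
rewrite /L2norm unlock.
have m2 (h : T -> R) : measurable_fun [set: T] h ->
    measurable_fun [set: T] (fun x => `|(EFin \o h) x| `^ 2)%E.
  move=> mh; apply: (measurableT_comp (measurable_poweR 2)).
  by apply: measurableT_comp => //; exact/measurable_EFinP.
have i0 (h : T -> R) : (\int[mu]_x (`|(EFin \o h) x| `^ 2))%E \in `[0%E, +oo%E].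
  rewrite in_itv; apply/andP; split; last exact: leey.
  apply: integral_ge0 => x _; exact: poweR_ge0.
apply: gt0_ler_poweR (i0 _) (i0 _) _; first by rewrite invr_ge0.
apply: ge0_le_integral => //.
- by move=> x _; exact: poweR_ge0.
- exact: m2.
- by apply: m2; exact: measurable_funD.
move=> x _; apply: gt0_ler_poweR => //; rewrite ?in_itv /= ?leey ?lee_fin ?normr_ge0 //.
have le0 := le_normcD (f x) (g x).
rewrite !ger0_norm ?addr_ge0 ?normc_ge0 //.
Qed.

Lemma L2normZ (a : R[i]) f : f \in L2pred -> L2norm (a *: f)%R = ((normc a)%:E * L2norm f)%E.
Proof.
move=> /L2predP[mf ff].
have p1 : (1 <= 2%:E :> \bar R)%E by rewrite lee_fin ler1n.
have fL : modulus f \in Lfun mu 2%:E.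
  by apply/andP; split; rewrite inE //=; exact: measurable_modulus.
have /= := LnormZ (Lfun_Sub p1 fL) (normc a).
rewrite ger0_norm ?normc_ge0 // => <-.
by apply: eq_Lnorm => x /=; rewrite /modulus normcM.
Qed.

Lemma L2pred_submod_closed : submod_closed L2pred.
Proof.
split.
- by apply/L2predP; split; [exact: cmeasurable0|rewrite L2norm0].
- move=> a f g fL gL; have /L2predP[mf ff] := fL; have /L2predP[mg fg] := gL.
  have maf := cmeasurableZ a mf.
  apply/L2predP; split; first exact: cmeasurableD.
  apply: le_lt_trans (L2normD maf mg) _.
  rewrite lte_add_pinfty // L2normZ //.
  by rewrite lte_mul_pinfty // ?lee_fin ?normc_ge0.
Qed.

HB.instance Definition _ := GRing.isSubmodClosed.Build R[i] (T -> R[i]) L2pred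
  L2pred_submod_closed.

(* Square-integrable functions, before identification almost everywhere. *)
Record L2fun := MkL2fun { L2val :> T -> R[i]; _ : L2val \in L2pred }.
HB.instance Definition _ := [isSub for L2val].
HB.instance Definition _ := [Choice of L2fun by <:].
HB.instance Definition _ := [SubChoice_isSubLmodule of L2fun by <:].

Definition L2null : {pred L2fun} :=
  [pred f : L2fun | `[< L2val f = cst 0 %[ae mu] >]].

Lemma L2nullP (f : L2fun) : reflect (L2val f = cst 0 %[ae mu]) (f \in L2null).
Proof. by rewrite inE; exact: asboolP. Qed.

Lemma L2null_zmod_closed : zmod_closed L2null.
Proof.
split.
- by apply/L2nullP; apply: aeW => x.
- move=> f g /L2nullP f0 /L2nullP g0; apply/L2nullP.
  near=> x => _.
  have fx : L2val f x = 0 by near: x; apply: filterS f0 => y; exact.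
  have gx : L2val g x = 0 by near: x; apply: filterS g0 => y; exact.
  by rewrite -[LHS]/(L2val f x - L2val g x) fx gx subr0.
Unshelve. all: by end_near. Qed.

HB.instance Definition _ := GRing.isZmodClosed.Build L2fun L2null L2null_zmod_closed.

Definition L2 : Type := Quotient.quot L2null.
HB.instance Definition _ := Choice.on L2.
HB.instance Definition _ := GRing.Zmodule.on L2.
HB.instance Definition _ := EqQuotient.on L2.

Lemma eq_L2P (f g : L2fun) : \pi_L2 f = \pi_L2 g <-> L2val f = L2val g %[ae mu].
Proof.
split.
- move=> /eqP; rewrite -Quotient.idealrBE => /L2nullP fg.
  apply: filterS fg => x /(_ I) fgx _; apply/eqP; rewrite -subr_eq0.
  exact/eqP.
- move=> fg; apply/eqP; rewrite -Quotient.idealrBE; apply/L2nullP.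
  apply: filterS fg => x /(_ I) fgx _.
  by rewrite -[LHS]/(L2val f x - L2val g x) fgx subrr.
Qed.

Definition L2scale (a : R[i]) (u : L2) : L2 := \pi_L2 (a *: repr u).

Lemma L2_repr (f : L2fun) : L2val (repr (\pi_L2 f)) = L2val f %[ae mu].
Proof. by apply/eq_L2P; rewrite reprK. Qed.

Lemma L2scale_pi a (f : L2fun) : L2scale a (\pi_L2 f) = \pi_L2 (a *: f).
Proof.
apply/eq_L2P; apply: filterS (L2_repr f) => x /(_ I) fx _.
by rewrite -[LHS]/(a *: L2val (repr (\pi_L2 f)) x) fx.
Qed.

Lemma L2scaleA a b u : L2scale a (L2scale b u) = L2scale (a * b) u.
Proof. by elim/quotW: u => f; rewrite (L2scale_pi b f) !L2scale_pi scalerA. Qed.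

Lemma L2scale1 : left_id 1 L2scale.
Proof. by elim/quotW => f; rewrite L2scale_pi scale1r. Qed.

Lemma L2piD (f g : L2fun) : \pi_L2 (f + g) = \pi_L2 f + \pi_L2 g.
Proof. exact: (@pi_addr _ _ _ _ _ L2). Qed.

Lemma L2scaleDr : right_distributive L2scale +%R.
Proof.
move=> a; elim/quotW => f; elim/quotW => g; rewrite -L2piD !L2scale_pi.
by rewrite scalerDr L2piD.
Qed.

Lemma L2scaleDl u : {morph L2scale^~ u : a b / a + b}.
Proof. elim/quotW: u => f a b /=; by rewrite !L2scale_pi scalerDl L2piD. Qed.

HB.instance Definition _ := GRing.Zmodule_isLmodule.Build R[i] L2
  L2scaleA L2scale1 L2scaleDr L2scaleDl.

Lemma L2piZ a (f : L2fun) : \pi_L2 (a *: f) = a *: \pi_L2 f.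
Proof. exact: esym (L2scale_pi a f). Qed.

(* The norm of a normed module over R[i] takes its values in R[i]. *)
Definition L2normf (u : L2) : R[i] := (fine (L2norm (repr u)))%:C.

Lemma ae_eq_L2norm f g : cmeasurable f -> cmeasurable g ->
  f = g %[ae mu] -> L2norm f = L2norm g.
Proof.
move=> mf mg fg; rewrite /L2norm unlock; congr (_ `^ _)%E.
have m2 (h : T -> R[i]) : cmeasurable h ->
    measurable_fun [set: T] (fun x => `|(EFin \o modulus h) x| `^ 2)%E.
  move=> /measurable_modulus mh; apply: (measurableT_comp (measurable_poweR 2)).
  by apply: measurableT_comp => //; exact/measurable_EFinP.
apply: ae_eq_integral; [by []|exact: m2|exact: m2|].
by apply: filterS fg => x /(_ I) /= fgx _; rewrite /modulus fgx.
Qed.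

Lemma L2fun_meas (f : L2fun) : cmeasurable f.
Proof. by case: f => f /= /L2predP[]. Qed.

Lemma L2fun_fin (f : L2fun) : L2norm f \is a fin_num.
Proof. by case: f => f /= /L2predP[_ ?]; rewrite ge0_fin_numE ?L2norm_ge0. Qed.

Lemma L2normf_pi (f : L2fun) : L2normf (\pi_L2 f) = (fine (L2norm f))%:C.
Proof.
by rewrite /L2normf (ae_eq_L2norm _ _ (L2_repr f)) //; exact: L2fun_meas.
Qed.

Lemma L2normf_triangle u v : L2normf (u + v) <= L2normf u + L2normf v.
Proof.
elim/quotW: u => f; elim/quotW: v => g; rewrite -L2piD !L2normf_pi -rmorphD lecR.
rewrite -fineD ?L2fun_fin // fine_le ?fin_numD ?L2fun_fin //.
by apply: L2normD; exact: L2fun_meas.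
Qed.

Lemma L2normf_scale (a : R[i]) u : L2normf (a *: u) = `|a| * L2normf u.
Proof.
elim/quotW: u => f; rewrite -L2piZ !L2normf_pi L2normZ; last exact: valP.
by rewrite fineM ?L2fun_fin // rmorphM.
Qed.

Lemma L2normf_eq0 u : L2normf u = 0 -> u = 0.
Proof.
elim/quotW: u => f; rewrite L2normf_pi => -[/eqP].
rewrite fine_eq0 ?L2fun_fin // => /eqP /Lnorm_eq0_eq0 f0.
have {}f0 : EFin \o modulus f = \0%E %[ae mu].
  by apply: f0 => //; apply/measurable_EFinP/measurable_modulus/L2fun_meas.
have -> : (0 : L2) = \pi_L2 0 by rewrite -(scale0r (0 : L2fun)) L2piZ scale0r.
apply/eq_L2P; apply: filterS f0 => x /(_ I) /= -[fx0] _.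
exact: eq0_normc.
Qed.

HB.instance Definition _ := Lmodule_isNormed.Build R[i] L2
  L2normf_triangle L2normf_scale L2normf_eq0.

Lemma L2_normE (f : L2fun) : `|\pi_L2 f| = (fine (L2norm f))%:C.
Proof. exact: L2normf_pi. Qed.

End L2.

Section unimodular_multiplication.
Context d (T : measurableType d) (R : realType).
Variable mu : {measure set T -> \bar R}.
Variable phi : T -> R[i].
Hypotheses (mphi : cmeasurable phi) (phi1 : forall x, `|phi x| = 1).

Lemma normc_phiM (f : T -> R[i]) x : normc (phi x * f x) = normc (f x).
Proof. by rewrite normcM; case: (phi1 x) => ->; rewrite mul1r. Qed.

Lemma L2pred_mul (f : L2fun mu) : (fun x => phi x * f x) \in L2pred mu.
Proof.
have /L2predP[mf ff] := valP f.
apply/L2predP; split; first exact: cmeasurableM.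
by rewrite (@eq_L2norm _ _ _ _ _ (L2val f)) // => x; exact: normc_phiM.
Qed.

Definition L2fun_mul (f : L2fun mu) : L2fun mu := MkL2fun (L2pred_mul f).

Definition L2mul (u : L2 mu) : L2 mu := \pi_(L2 mu) (L2fun_mul (repr u)).

Lemma L2mul_pi (f : L2fun mu) :
  L2mul (\pi_(L2 mu) f) = \pi_(L2 mu) (L2fun_mul f).
Proof.
by apply/eq_L2P; apply: filterS (L2_repr f) => x /(_ I) fx _ /=; rewrite fx.
Qed.

Lemma L2mul_linear : linear L2mul.
Proof.
move=> a; elim/quotW => f; elim/quotW => g.
rewrite -L2piZ -L2piD !L2mul_pi -L2piZ -L2piD; congr (\pi_(L2 mu) _).
by apply/val_inj/funext => x; rewrite /= mulrDr; congr (_ + _); exact: mulrCA.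
Qed.

Lemma L2mul_norm u : `|L2mul u| = `|u|.
Proof.
elim/quotW: u => f; rewrite L2mul_pi !L2_normE.
by rewrite (@eq_L2norm _ _ _ _ _ (L2val f)) // => x; exact: normc_phiM.
Qed.

End unimodular_multiplication.

(* A linear isometric action preserves the inner product (polarization) and each
   operator is invertible, with inverse the action of the opposite element: on a
   Hilbert space this is exactly a unitary representation. The abelian group G is
   written additively. *)
Record unitary_rep (R : realType) (G : zmodType) (H : normedModType R[i]) := {
  rep_act :> G -> H -> H;
  rep_linear : forall g, linear (rep_act g);
  rep_norm : forall g v, `|rep_act g v| = `|v|;
  rep0 : forall v, rep_act 0 v = v;
  repD : forall g h v, rep_act (g + h) v = rep_act g (rep_act h v)
}.

Definition directed (I : Type) (le : I -> I -> Prop) : Prop :=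
  [/\ inhabited I, forall i, le i i,
      forall i j k, le i j -> le j k -> le i k &
      forall i j, exists k, le i k /\ le j k].

Definition net_filter (I : Type) (le : I -> I -> Prop) : set_system I :=
  filter_from [set: I] (fun i => [set j | le i j]).

Definition has_almost_invariant_vectors (R : realType) (G : zmodType)
    (H : normedModType R[i]) (pi : unitary_rep G H) : Prop :=
  exists (I : Type) (le : I -> I -> Prop) (v : I -> H),
    [/\ directed le, forall i, `|v i| = 1 &
        forall g, (`|pi g (v i) - v i| : R[i]^o) @[i --> net_filter le] --> (0 : R[i]^o)].

Definition borel (T : ptopologicalType) : Type := g_sigma_algebraType (@open T).
HB.instance Definition _ (T : ptopologicalType) :=
  Measurable.on (borel T).

(* Compact sets are not assumed closed in T; for the Hausdorff spaces considered
   here they are Borel. *)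
Definition regular_borel (R : realType) (T : ptopologicalType)
    (mu : {measure set (borel T) -> \bar R}) : Prop :=
  [/\ forall K : set T, compact K -> (mu K < +oo)%E,
      forall A : set (borel T), measurable A ->
        mu A = ereal_inf [set mu U | U in [set U : set T | open U /\ A `<=` U]] &
      forall A : set (borel T), measurable A ->
        mu A = ereal_sup [set mu K | K in [set K : set T | compact K /\ K `<=` A]]].

Definition measure_support (R : realType) (T : ptopologicalType)
    (mu : {measure set (borel T) -> \bar R}) : set T :=
  ~` \bigcup_(U in [set U : set T | open U /\ mu U = 0%E]) U.

Lemma measure_supportP (R : realType) (T : ptopologicalType)
    (mu : {measure set (borel T) -> \bar R}) (x : T) :
  measure_support mu x <-> forall U : set T, open U -> U x -> (0 < mu U)%E.
Proof.
split=> [sx U oU Ux|H [U [oU U0] Ux]].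
  rewrite lt0e measure_ge0 andbT; apply/eqP => U0.
  by apply: sx; exists U.
by have := H U oU Ux; rewrite U0 ltxx.
Qed.

Section Pontryagin_dual.
Variables (R : realType) (G : zmodType).

(* {ptws G -> R[i]^o} carries the topology of pointwise convergence, and
   set_type the subspace topology; R[i]^o is R[i] with its norm topology. *)
Definition characters : set {ptws G -> R[i]^o} :=
  [set xi | (forall g, `|xi g| = 1) /\ (forall g h, xi (g + h) = xi g * xi h)].

Definition pontryagin_dual : Type := set_type characters.

HB.instance Definition _ := Topological.on pontryagin_dual.

Definition dual_fun (xi : pontryagin_dual) : G -> R[i] := set_val xi.
Coercion dual_fun : pontryagin_dual >-> Funclass.

Lemma dual_norm (xi : pontryagin_dual) g : `|xi g| = 1.
Proof. by have [] := set_valP xi. Qed.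

Lemma dualD (xi : pontryagin_dual) g h : xi (g + h) = xi g * xi h.
Proof. by have [] := set_valP xi. Qed.

Lemma dual0 (xi : pontryagin_dual) : xi 0 = 1.
Proof.
have /eqP := dualD xi 0 0; rewrite addr0 -{1}[xi 0]mulr1 => /eqP.
by move/mulfI => -> //; rewrite -normr_eq0 dual_norm oner_neq0.
Qed.

Lemma trivial_character_subproof : (fun=> 1 : R[i]) \in characters.
Proof. by apply/mem_set; split => [g|g h]; rewrite ?normr1 ?mulr1. Qed.

Definition trivial_character : pontryagin_dual :=
  exist _ (fun=> 1 : R[i]) trivial_character_subproof.

HB.instance Definition _ := isPointed.Build pontryagin_dual trivial_character.

Lemma dual_eval_continuous g : continuous (fun xi : pontryagin_dual => xi g : R[i]^o).
Proof.
move=> xi.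
apply: (@continuous_comp pontryagin_dual {ptws G -> R[i]^o} R[i]^o set_val (proj g)).
  exact: initial_continuous.
exact: proj_continuous.
Qed.

Lemma Re_continuous : continuous (@complex.Re R : R[i]^o -> R).
Proof.
move=> z; apply/(@cvgrPdist_lt _ _ _ _ (nbhs_filter (z : R[i]^o))) => e e0.
exists e%:C => /=; first by rewrite ltcR.
move=> w /=; rewrite -ltcR; apply: le_lt_trans.
rewrite -(_ : complex.Re (z - w) = complex.Re z - complex.Re w); first exact: normc_ge_Re.
by case: z => ? ?; case: w.
Qed.

Lemma Im_continuous : continuous (@complex.Im R : R[i]^o -> R).
Proof.
move=> z; apply/(@cvgrPdist_lt _ _ _ _ (nbhs_filter (z : R[i]^o))) => e e0.
exists e%:C => /=; first by rewrite ltcR.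
move=> w /=; rewrite -ltcR; apply: le_lt_trans.
rewrite -(_ : complex.Im (z - w) = complex.Im z - complex.Im w); last first.
  by case: z => ? ?; case: w.
case: (z - w) => a b; simpc.
by rewrite -sqrtr_sqr ler_wsqrtr // lerDr sqr_ge0.
Qed.

Lemma continuous_borel_measurable (T : ptopologicalType) (f : T -> R) :
  continuous f -> measurable_fun [set: borel T] (f : borel T -> R).
Proof.
move=> /continuousP cf; apply: (measurability _ (RGenOpens.measurableE R)).
move=> _ [_ [a [b ->] <-]]; rewrite setTI; apply: sub_sigma_algebra.
exact/cf/interval_open.
Qed.

Definition conj_eval (g : G) : borel pontryagin_dual -> R[i] := fun xi => ((xi : pontryagin_dual) g)^*.

Lemma conj_eval_cmeasurable g : cmeasurable (conj_eval g).
Proof.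
have Re_eval : continuous (fun xi : pontryagin_dual => complex.Re (xi g)).
  move=> xi; apply: (@continuous_comp pontryagin_dual R[i]^o R (fun xi : pontryagin_dual => xi g)).
    exact: dual_eval_continuous.
  exact: Re_continuous.
have Im_eval : continuous (fun xi : pontryagin_dual => complex.Im (xi g)).
  move=> xi; apply: (@continuous_comp pontryagin_dual R[i]^o R (fun xi : pontryagin_dual => xi g)).
    exact: dual_eval_continuous.
  exact: Im_continuous.
split.
- rewrite (_ : (fun xi => _) = (fun xi : pontryagin_dual => complex.Re (xi g))).
    exact: continuous_borel_measurable.
  by apply/funext => xi; rewrite /conj_eval; case: ((xi : pontryagin_dual) g).
- rewrite (_ : (fun xi => _) = \- (fun xi : pontryagin_dual => complex.Im (xi g))).
    by apply: measurableT_comp => //; exact: continuous_borel_measurable.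
  by apply/funext => xi; rewrite /conj_eval /=; case: ((xi : pontryagin_dual) g).
Qed.

Lemma conj_eval_unimodular g xi : `|conj_eval g xi| = 1.
Proof. by rewrite normcJ dual_norm. Qed.

Variable nu : {measure set (borel pontryagin_dual) -> \bar R}.

Definition pi_act (g : G) : L2 nu -> L2 nu :=
  L2mul (conj_eval_cmeasurable g) (conj_eval_unimodular g).

Lemma pi_act0 u : pi_act 0 u = u.
Proof.
elim/quotW: u => f; rewrite /pi_act L2mul_pi; congr (\pi_(L2 nu) _).
by apply/val_inj/funext => xi; rewrite /= /conj_eval dual0 conjc1 mul1r.
Qed.

Lemma pi_actD g h u : pi_act (g + h) u = pi_act g (pi_act h u).
Proof.
elim/quotW: u => f; rewrite /pi_act.
rewrite (L2mul_pi (conj_eval_cmeasurable h) (conj_eval_unimodular h) f) !L2mul_pi.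
congr (\pi_(L2 nu) _).
by apply/val_inj/funext => xi; rewrite /= /conj_eval dualD rmorphM mulrA.
Qed.

Definition pi_nu : unitary_rep G (L2 nu) :=
  {| rep_act := pi_act;
     rep_linear := fun g => L2mul_linear _ _;
     rep_norm := fun g => L2mul_norm _ _;
     rep0 := pi_act0;
     repD := pi_actD |}.

Lemma pi_nu_ae (g : G) (u : L2 nu) :
  L2val (repr (pi_nu g u)) = (fun xi => conj_eval g xi * L2val (repr u) xi)
    %[ae nu].
Proof. exact: L2_repr. Qed.

End Pontryagin_dual.

(* Main.v *)
Require Import Defs.
From mathcomp Require Import all_boot all_order all_algebra.
From mathcomp Require Import all_classical all_reals all_analysis.
From mathcomp Require Import measurable_realfun complex.

Set Implicit Arguments.
Unset Strict Implicit.
Unset Printing Implicit Defensive.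

(** Write v for a unit vector of L2(nu). The vector pi_nu(g) v - v has modulus
    |xi(g) - 1| |v(xi)| at xi, so pi_nu moves v little exactly when the mass of
    |v|^2 sits where xi(g) is close to 1. The theorem compares this with the
    neighbourhoods of the trivial character 1, which are generated by the sets
    {xi | |xi(g) - 1| < e for all g in s} with s finite and e > 0
    ([nbhs_dual_eval]).

    If an open U containing 1 is nu-null, choose s and e so that U contains the
    set above. Almost everywhere some g in s then has |xi(g) - 1| >= e, whence
    e |v(xi)| <= sum_(g in s) |xi(g) - 1| |v(xi)|, and Minkowski's inequality
    gives e <= sum_(g in s) ||pi_nu(g) v - v|| for every unit vector v
    ([pi_nu_displacement_ge]): no net of unit vectors is almost invariant.

    If every open U containing 1 has positive measure, inner regularity provides
    a compact K inside U with 0 < nu K < +oo, and the normalized indicator of K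
    is a unit vector concentrated on U ([concentrated_unit_vector]). Indexed by
    the neighbourhoods U of 1 under reverse inclusion, these vectors form an
    almost invariant net: once |xi(g) - 1| <= e on U, the vector of U is moved
    by at most e under g ([pi_nu_displacement_le]). *)

Import Order.TTheory GRing.Theory Num.Theory.
Import numFieldTopology.Exports numFieldNormedType.Exports.
Import ComplexField.Normc.

Local Open Scope classical_set_scope.
Local Open Scope ring_scope.
Local Open Scope complex_scope.
Local Open Scope quotient_scope.

(** * Topology of the dual group and regularity *)

Section dual_topology.
Variables (R : realType) (G : zmodType).
Local Notation dual := (pontryagin_dual R G).

Lemma dual_hausdorff : hausdorff_space dual.
Proof.
move=> p q pq; apply/val_inj/funext => g.
apply: (@norm_hausdorff _ R[i]^o) => A B Ap Bq.
have [xi [Axi Bxi]] := pq _ _ (@dual_eval_continuous R G g p A Ap)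
                            (@dual_eval_continuous R G g q B Bq).
by exists (dual_fun xi g).
Qed.

(** The topology of the dual is a subspace topology of a product topology, that
    is an initial topology of a supremum of initial topologies. Instead of
    unfolding its neighbourhoods, the proof takes the filter generated by the
    sets on the right and checks that it converges to [xi0], which reduces to
    one coordinate at a time. *)
Lemma nbhs_dual_eval (xi0 : dual) (U : set dual) : nbhs xi0 U ->
  exists (s : seq G) (e : R), 0 < e /\
    forall xi : dual,
      {in s, forall g, normc (dual_fun xi g - dual_fun xi0 g) < e} -> U xi.
Proof.
pose N (p : seq G * R) :=
  [set xi : dual | {in p.1, forall g, normc (dual_fun xi g - dual_fun xi0 g) < p.2}].
pose B := filter_from [set p : seq G * R | 0 < p.2] N.
have BF : Filter B.
  apply: filter_from_filter; first by exists ([::], 1); rewrite /= ltr01.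
  move=> [s e] [t d] /= e0 d0; exists (s ++ t, Num.min e d) => /=.
    by rewrite lt_min e0 d0.
  move=> xi /= H; split=> g gs; have /= := H g; rewrite mem_cat gs ?orbT lt_min.
    by move=> /(_ isT)/andP[].
  by move=> /(_ isT)/andP[].
suff BC : B --> xi0.
  by move=> /BC [[s e] /= e0 sU]; exists s, e; split.
have cvN : set_val @ B --> (set_val xi0 : {ptws G -> R[i]^o}).
  apply/cvg_sup => g A /= [_ [[D oD <-] Dg sA]].
  have : nbhs (dual_fun xi0 g : R[i]^o) D by apply: open_nbhs_nbhs.
  move=> [[e ei] /= e0 he].
  (* Radii are elements of [R[i]]; being positive forces them to be real. *)
  have ei0 : ei = 0 by move: e0; rewrite ltcE /= => /andP[/eqP].
  exists ([:: g], e) => /=; first by move: e0; rewrite ltcE => /andP[].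
  move=> xi /= H; apply: sA; apply: he => /=.
  by rewrite distrC ei0 ltcR; apply: H; rewrite inE.
move=> A [_ [[D oD <-] Dg sA]].
have : nbhs (set_val xi0 : {ptws G -> R[i]^o}) D by apply: open_nbhs_nbhs.
move=> /cvN BD; apply: (@filterS _ B BF _ _ sA); exact: BD.
Qed.

End dual_topology.

Lemma compact_borel (T : ptopologicalType) (K : set T) :
  hausdorff_space T -> compact K -> measurable (K : set (borel T)).
Proof.
move=> hT /(compact_closed hT) cK.
rewrite -[K]setCK; apply: measurableC; apply: sub_sigma_algebra.
exact: closed_openC.
Qed.

(** Inner regularity at [U], where finiteness on compact sets bounds the measure
    of the approximating set even if [U] has infinite measure. *)
Lemma positive_compact_subset (R : realType) (T : ptopologicalType)
    (mu : {measure set (borel T) -> \bar R}) (U : set T) :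
  hausdorff_space T -> regular_borel mu -> open U -> (0 < mu U)%E ->
  exists K : set (borel T),
    [/\ measurable K, K `<=` U, (0 < mu K)%E & (mu K < +oo)%E].
Proof.
move=> hT [Kfin _ Kinner] oU U0.
have [[K [cK KU] K0]|H] := pselect (exists2 K : set T,
   compact K /\ K `<=` U & (0 < mu K)%E).
  by exists K; split => //; [exact: compact_borel|exact: Kfin].
move: U0; rewrite (Kinner U); last exact: sub_sigma_algebra.
rewrite ltNge => /negP[]; apply: ge_ereal_sup => _ [K [cK KU] <-].
by rewrite leNgt; apply/negP => K0; apply: H; exists K.
Qed.

(** * Norm estimates in L2 *)

Lemma normc_real (R : realType) (r : R) : normc r%:C = `|r|.
Proof. by rewrite normc_ReIm /= expr0n addr0 sqrtr_sqr. Qed.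

Section L2_extra.
Context d (T : measurableType d) (R : realType).
Variable mu : {measure set T -> \bar R}.

Lemma L2pi0 : \pi_(L2 mu) (0 : L2fun mu) = 0.
Proof. by rewrite -(scale0r (0 : L2fun mu)) L2piZ scale0r. Qed.

Lemma L2piB (f g : L2fun mu) : \pi_(L2 mu) (f - g) = \pi_(L2 mu) f - \pi_(L2 mu) g.
Proof. by rewrite -scaleN1r L2piD L2piZ scaleN1r. Qed.

Lemma ae_le_normL2 (f g : L2fun mu) :
  {ae mu, forall x, normc (f x) <= normc (g x)} ->
  `|\pi_(L2 mu) f| <= `|\pi_(L2 mu) g|.
Proof.
move=> fg; rewrite !L2_normE lecR fine_le ?L2fun_fin //.
rewrite /L2norm unlock.
have m2 (h : L2fun mu) :
    measurable_fun [set: T] (fun x => `|(EFin \o modulus h) x| `^ 2)%E.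
  apply: (measurableT_comp (measurable_poweR 2)).
  by apply: measurableT_comp => //; exact/measurable_EFinP/measurable_modulus/L2fun_meas.
have i0 (h : T -> R) : (\int[mu]_x (`|(EFin \o h) x| `^ 2))%E \in `[0%E, +oo%E].
  rewrite in_itv; apply/andP; split; last exact: leey.
  apply: integral_ge0 => x _; exact: poweR_ge0.
apply: gt0_ler_poweR (i0 _) (i0 _) _; first by rewrite invr_ge0.
apply: ae_ge0_le_integral => //.
- by move=> x _; exact: poweR_ge0.
- by move=> x _; exact: poweR_ge0.
apply: filterS fg => x fgx _.
apply: gt0_ler_poweR => //; rewrite ?in_itv /= ?leey ?lee_fin ?normr_ge0 //.
by rewrite !ger0_norm ?normc_ge0.
Qed.

Lemma L2pred_modulus (f : L2fun mu) : (fun x => (normc (f x))%:C) \in L2pred mu.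
Proof.
have /L2predP[mf ff] := valP f; apply/L2predP; split.
  split => /=; [exact: measurable_modulus|exact: measurable_cst].
rewrite (@eq_L2norm _ _ _ _ _ (L2val f)) // => x.
by rewrite [LHS]normc_real ger0_norm ?normc_ge0.
Qed.

Definition L2modulus (f : L2fun mu) : L2fun mu := MkL2fun (L2pred_modulus f).

Lemma normL2_modulus (f : L2fun mu) :
  `|\pi_(L2 mu) (L2modulus f)| = `|\pi_(L2 mu) f|.
Proof.
rewrite !L2_normE; congr ((fine _)%:C); apply: eq_L2norm => x.
by rewrite [LHS]normc_real ger0_norm ?normc_ge0.
Qed.

(** Minkowski's inequality, used as the triangle inequality of L2 applied to the
    moduli [|h i|] rather than to the [h i] themselves, whose
    sum may cancel. *)
Lemma ae_le_normL2_sum (I : Type) (s : seq I) (f : L2fun mu) (h : I -> L2fun mu) :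
  {ae mu, forall x, normc (f x) <= \sum_(i <- s) normc (h i x)} ->
  `|\pi_(L2 mu) f| <= \sum_(i <- s) `|\pi_(L2 mu) (h i)|.
Proof.
move=> fh; pose H := \sum_(i <- s) L2modulus (h i).
have HE x : L2val H x = (\sum_(i <- s) normc (h i x))%:C.
  rewrite (big_morph (fun k : L2fun mu => L2val k x)
    (id1 := 0) (op1 := +%R)) //.
  by rewrite [RHS](raddf_sum (real_complex R)).
have -> : \sum_(i <- s) `|\pi_(L2 mu) (h i)| =
          \sum_(i <- s) `|\pi_(L2 mu) (L2modulus (h i))|.
  by apply: eq_bigr => i _; rewrite normL2_modulus.
apply: le_trans (ler_norm_sum _ _ _).
rewrite -(big_morph _ (@L2piD _ _ _ mu) L2pi0).
apply: ae_le_normL2; apply: filterS fh => x fhx.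
rewrite HE normc_real; apply: le_trans fhx _; exact: ler_norm.
Qed.

Lemma L2pred_indic (K : set T) : measurable K -> (mu K < +oo)%E ->
  (fun x => (\1_K x)%:C : R[i]) \in L2pred mu.
Proof.
move=> mK fK; apply/L2predP; split.
  by split => /=; [exact: measurable_indic|exact: measurable_cst].
rewrite /L2norm unlock poweR_lty //.
rewrite (_ : (\int[mu]_x _)%E = (\int[mu]_x (\1_K x)%:E)%E).
  by rewrite integral_indic // setIT.
apply: eq_integral => x _ /=.
rewrite /modulus normc_real normr_id.
rewrite indicE; case: (x \in K); rewrite ?normr1 ?normr0 /=.
  by rewrite powR1.
by rewrite powR0.
Qed.

Lemma indicL2_neq0 (K : set T) (mK : measurable K) (fK : (mu K < +oo)%E) :
  (0 < mu K)%E -> \pi_(L2 mu) (MkL2fun (L2pred_indic mK fK)) != 0.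
Proof.
move=> K0; apply/eqP; rewrite -L2pi0 => /eq_L2P /= [N [mN N0 sN]].
have : (mu K <= mu N)%E.
  apply: le_measure; rewrite ?inE //; apply: subset_trans sN => x Kx /= /(_ I).
  rewrite indicE mem_set // => /(congr1 (@complex.Re R)) /= /eqP.
  by rewrite oner_eq0.
by rewrite N0 leNgt K0.
Qed.

End L2_extra.

(** * Displacement of vectors under the representation *)

Section regular_representation.
Variables (R : realType) (G : zmodType).
Local Notation dual := (borel (pontryagin_dual R G)).
Variable nu : {measure set dual -> \bar R}.

Lemma pi_nu_sub_pi (g : G) (f : L2fun nu) :
  pi_nu nu g (\pi_(L2 nu) f) - \pi_(L2 nu) f =
  \pi_(L2 nu)
    (L2fun_mul (conj_eval_cmeasurable R g) (conj_eval_unimodular g) f - f).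
Proof. by rewrite L2piB; congr (_ - _); exact: L2mul_pi. Qed.

(** The representation multiplies by the conjugate of [xi g], which is as far
    from [1] as [xi g] itself. *)
Lemma normc_conj_eval_sub (g : G) (f : L2fun nu) (xi : dual) :
  normc ((L2fun_mul (conj_eval_cmeasurable R g) (conj_eval_unimodular g) f - f) xi) =
  normc (dual_fun xi g - 1) * normc (f xi).
Proof.
rewrite -[L2val _ xi]/(conj_eval g xi * f xi - f xi).
rewrite -{2}[f xi]mul1r -mulrBl normcM; congr (_ * _).
rewrite /conj_eval; case: (dual_fun _ _) => a b.
by rewrite !normc_ReIm /= !oppr0 !addr0 sqrrN.
Qed.

(** Outside the null set some term of the sum is already at least [e] times the
    modulus of the vector. *)
Lemma pi_nu_displacement_ge (s : seq G) (e : R) (u : L2 nu) : 0 < e ->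
  nu.-negligible [set xi : dual | {in s, forall g, normc (dual_fun xi g - 1) < e}] ->
  e%:C * `|u| <= \sum_(g <- s) `|pi_nu nu g u - u|.
Proof.
move=> e0 Hneg; elim/quotW: u => f.
under eq_bigr do rewrite pi_nu_sub_pi.
have -> : e%:C * `|\pi_(L2 nu) f| = `|\pi_(L2 nu) (e%:C *: f)|.
  by rewrite L2piZ normrZ; congr (_ * _); rewrite ger0_norm // lecR ltW.
apply: ae_le_normL2_sum.
apply: negligibleS Hneg => xi /= H g gs; rewrite ltNge; apply/negP => eg.
apply: H; rewrite (big_rem g gs) /= normc_conj_eval_sub.
rewrite -[X in normc X <= _]/(e%:C * f xi) normcM normc_real gtr0_norm //.
apply: (le_trans (ler_wpM2r (normc_ge0 _) eg)).
by rewrite lerDl; apply: sumr_ge0 => h _; exact: normc_ge0.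
Qed.

Lemma pi_nu_displacement_le (g : G) (e : R) (f : L2fun nu) : 0 < e ->
  (forall xi, f xi != 0 -> normc (dual_fun xi g - 1) <= e) ->
  `|pi_nu nu g (\pi_(L2 nu) f) - \pi_(L2 nu) f| <= e%:C * `|\pi_(L2 nu) f|.
Proof.
move=> e0 Hf; rewrite pi_nu_sub_pi.
have -> : e%:C * `|\pi_(L2 nu) f| = `|\pi_(L2 nu) (e%:C *: f)|.
  by rewrite L2piZ normrZ; congr (_ * _); rewrite ger0_norm // lecR ltW.
apply: ae_le_normL2; apply: aeW => xi; rewrite normc_conj_eval_sub.
rewrite -[X in _ <= normc X]/(e%:C * f xi) normcM normc_real gtr0_norm //.
have [->|/Hf fe] := eqVneq (f xi) 0; first by rewrite normc0 !mulr0.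
by apply: ler_wpM2r => //; exact: normc_ge0.
Qed.

(** The witness is the normalized indicator of a compact subset of [U]. *)
Lemma concentrated_unit_vector (U : set (pontryagin_dual R G)) :
  regular_borel nu -> measure_support nu (trivial_character R G) ->
  nbhs (trivial_character R G) U ->
  exists v : L2 nu, `|v| = 1 /\
    forall (g : G) (e : R), 0 < e ->
      U `<=` [set xi | normc (dual_fun xi g - 1) <= e] ->
      `|pi_nu nu g v - v| <= e%:C.
Proof.
move=> nureg /measure_supportP supp; rewrite nbhsE => -[V [oV V1] VU].
have [K [mK KV K0 Kfin]] :=
  positive_compact_subset (@dual_hausdorff R G) nureg oV (supp V oV V1).
have := indicL2_neq0 mK Kfin K0.
set f := MkL2fun _; set u := \pi_(L2 nu) f => u0.
have nu0 : `|u| != 0 by rewrite normr_eq0.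
exists (`|u|^-1 *: u); split; first by rewrite normrZ normfV normr_id mulVf.
move=> g e e0 Ue.
have -> : pi_nu nu g (`|u|^-1 *: u) = `|u|^-1 *: pi_nu nu g u.
  have lin := @rep_linear _ _ _ (pi_nu nu) g.
  have p0 : pi_nu nu g 0 = 0.
    have := lin 1 0 0; rewrite !scale1r !addr0.
    by rewrite -[in LHS](addr0 (pi_nu nu g 0)) => /addrI.
  by have := lin `|u|^-1 u 0; rewrite p0 !addr0.
rewrite -scalerBr normrZ normfV normr_id mulrC ler_pdivrMr ?normr_gt0 //.
apply: pi_nu_displacement_le => // xi fxi; apply: Ue; apply: VU; apply: KV.
by apply: contrapT => nK; move: fxi; rewrite /f /= indicE memNset // eqxx.
Qed.

End regular_representation.

(** * Convergence along nets *)

Lemma net_filter_filter (I : Type) (le : I -> I -> Prop) :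
  directed le -> ProperFilter (net_filter le).
Proof.
move=> [[i0] le_refl le_trans le_dir]; apply: filter_from_proper.
  apply: filter_from_filter; first by exists i0.
  move=> i j _ _; have [k [ik jk]] := le_dir i j; exists k => // l kl.
  by split; [exact: le_trans kl|exact: le_trans kl].
by move=> i _; exists i; exact: le_refl.
Qed.

Lemma near_sum_lt (R : realType) (I J : Type) (F : set_system I) (FF : Filter F)
    (s : seq J) (h : J -> I -> R[i]) (e : R) : 0 < e ->
  (forall j i, 0 <= h j i) ->
  (forall j, (h j i : R[i]^o) @[i --> F] --> (0 : R[i]^o)) ->
  \forall i \near F, \sum_(j <- s) h j i < e%:C.
Proof.
move=> e0 h0 hc.
have : (\sum_(j <- s) h j i : R[i]^o) @[i --> F] --> (0 : R[i]^o).
  elim: s => [|j s IH].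
    by under eq_cvg do rewrite big_nil; exact: cvg_cst.
  under eq_cvg do rewrite big_cons.
  by have := cvgD (hc j) IH; rewrite addr0; exact.
have nS : nbhs (0 : R[i]^o) [set z : R[i] | `|z| < e%:C].
  exists e%:C => /=; first by rewrite ltcR.
  by move=> z /=; rewrite sub0r normrN.
move=> /(_ _ nS) nF; apply: (@filterS _ F FF _ _ _ nF) => i /=.
by rewrite ger0_norm // sumr_ge0.
Qed.

(** * Almost invariant vectors and the support *)

Theorem theorem2p16 (R : realType) (G : zmodType)
    (nu : {measure set (borel (pontryagin_dual R G)) -> \bar R}) :
  ([set: G] #= [set: nat])%card ->
  regular_borel nu ->
  has_almost_invariant_vectors (pi_nu nu) <->
  measure_support nu (trivial_character R G).
Proof.
move=> _ nureg; split=> [[I [le [v [le_dir v1 cv]]]]|supp].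
  apply/measure_supportP => U oU U1; rewrite lt0e measure_ge0 andbT.
  apply/eqP => U0.
  have [s [e [e0 sU]]] := nbhs_dual_eval (open_nbhs_nbhs (conj oU U1)).
  have PF := net_filter_filter le_dir.
  have small := near_sum_lt (@filter_filter _ _ PF) s e0
    (fun g i => normr_ge0 (pi_nu nu g (v i) - v i)) cv.
  case: (@filter_ex _ _ PF _ small) => i.
  have : e%:C * `|v i| <= \sum_(g <- s) `|pi_nu nu g (v i) - v i|.
    apply: pi_nu_displacement_ge => //.
    by exists U; split => //; exact: sub_sigma_algebra.
  by rewrite v1 mulr1 => ge_e /(le_lt_trans ge_e); rewrite ltxx.
pose N := {U : set (pontryagin_dual R G) | nbhs (trivial_character R G) U}.
have /choice[w wP] : forall U : N, exists v : L2 nu, `|v| = 1 /\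
    forall (g : G) (e : R), 0 < e ->
      sval U `<=` [set xi | normc (dual_fun xi g - 1) <= e] ->
      `|pi_nu nu g v - v| <= e%:C.
  by move=> [U nU]; exact: concentrated_unit_vector.
exists N, (fun U V => sval V `<=` sval U), w; split.
- split.
  + by split; exists setT; exact: filterT.
  + by move=> U.
  + by move=> U V W VU WV; exact: subset_trans VU.
  + move=> [U nU] [V nV].
    have nUV : nbhs (trivial_character R G) (U `&` V) by exact: filterI.
    by exists (exist _ _ nUV); split => xi /= [].
- by move=> U; have [] := wP U.
move=> g A [[e ei] /= e0 eA].
have ei0 : ei = 0 by move: e0; rewrite ltcE /= => /andP[/eqP].
have {}e0 : 0 < e by move: e0; rewrite ltcE => /andP[].
(* Half the radius, because the estimate for [w V] is not strict. *)
have nU : nbhs (trivial_character R G)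
    [set xi : pontryagin_dual R G | normc (dual_fun xi g - 1) <= e / 2].
  have nb : nbhs (1 : R[i]^o) [set z : R[i] | normc (z - 1) <= e / 2].
    exists (e / 2)%:C => /=; first by rewrite ltcR divr_gt0.
    by move=> z /=; rewrite distrC ltcR; exact: ltW.
  exact: (@dual_eval_continuous R G g (trivial_character R G) _ nb).
exists (exist _ _ nU) => // V /= VU; apply: eA => /=.
rewrite sub0r normrN normr_id ei0.
have [_ /(_ g (e / 2)) gV] := wP V.
apply: le_lt_trans (gV _ VU) _; first by rewrite divr_gt0.
by rewrite ltcR ltr_pdivrMr // mulr2n mulrDr mulr1 ltrDl.
Qed.
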